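(* Let $\mathbb{F}=\mathbb{R}$ or $\mathbb{C}$, let $0<r<m$ be integers, and let $P$ be a Borel probability measure on the Grassmannian $\mathrm{G}(m,r)$ of $r$-dimensional linear subspaces of $\mathbb{F}^m$. A parameter $\Sigma\in\mathrm{Pos}(m)$ is a Grassmannian maximum likelihood estimate (GE) of $P$ if and only if it satisfies the maximum likelihood equation $$\int_{\mathrm{G}(m,r)}\pi_U(\Sigma)\,dP(U)=\frac rm I,$$ where $I$ is the $m\times m$ identity matrix.
   Context: $A^*$ denotes the adjoint (transpose if $\mathbb{F}=\mathbb{R}$, conjugate transpose if $\mathbb{F}=\mathbb{C}$) of a matrix $A$. $\mathrm{Pos}(m)$ is the set of positive definite self-adjoint matrices $\Sigma\in\mathbb{F}^{m\times m}$ with $\det\Sigma=1$. For $\Sigma\in\mathrm{Pos}(m)$, the Grassmannian distribution $\mathcal{G}_\Sigma$ is the law on $\mathrm{G}(m,r)$ of the linear span of $r$ i.i.d. centered normal vectors in $\mathbb{F}^m$ with covariance matrix $\Sigma$ (circularly symmetric if $\mathbb{F}=\mathbb{C}$); $\mathcal{G}_I$ is the uniform distribution. For $U=\langle X\rangle$ the range of a matrix $X\in\mathbb{F}^{m\times r}$ of rank $r$, $$\frac{d\mathcal{G}_\Sigma}{d\mathcal{G}_I}(U)=\left(\frac{\det(X^*X)}{\det(X^*\Sigma^{-1}X)}\right)^{i_{\mathbb{F}}m/2},\qquad i_{\mathbb{F}}=\dim_{\mathbb{R}}\mathbb{F}.$$ A Grassmannian (maximum likelihood) estimate, abbreviated GE,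 of $P$ is a parameter $\Sigma\in\mathrm{Pos}(m)$ that maximizes $\int\log(d\mathcal{G}_\Sigma/d\mathcal{G}_I)\,dP$ over $\mathrm{Pos}(m)$; equivalently, it minimizes $\ell_P(\Sigma)=\int_{\mathrm{G}(m,r)}\ell_U(\Sigma)\,dP(U)$ over $\mathrm{Pos}(m)$, where $\ell_U(\Sigma)=\frac12\log\frac{\det(X^*\Sigma^{-1}X)}{\det(X^*X)}$ for $U=\langle X\rangle$. For $U\in\mathrm{G}(m,r)$, $\pi_U(\Sigma):\mathbb{F}^m\to\mathbb{F}^m$ is the $\Sigma$-orthogonal projector onto $U$, i.e. the orthogonal projector onto $U$ with respect to the scalar product $(x|y)_\Sigma=x^*\Sigma^{-1}y$; in matrix form $\pi_U(\Sigma)=X(X^*\Sigma^{-1}X)^{-1}X^*\Sigma^{-1}$ for $U=\langle X\rangle$. *)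

(* Defs.v *)
From HB Require Import structures.
From mathcomp Require Import all_boot all_order all_algebra complex.
From mathcomp Require Import all_classical all_reals all_analysis.

Set Implicit Arguments.
Unset Strict Implicit.
Unset Printing Implicit Defensive.

Import Order.TTheory GRing.Theory Num.Theory.
Import numFieldNormedType.Exports.

Local Open Scope classical_set_scope.
Local Open Scope ring_scope.

Variant scalars := real_scalars | complex_scalars.

Section Scalars.
Variable R : realType.

(* On R[i] the order is partial: 0 < z means that z is real and positive. *)
Definition scal (k : scalars) : numFieldType :=
  match k with real_scalars => R | complex_scalars => R[i] end.

Definition scal_dim (k : scalars) : nat :=
  match k with real_scalars => 1 | complex_scalars => 2 end.

Definition scal_conj (k : scalars) : {rmorphism scal k -> scal k} :=
  match k return {rmorphism scal k -> scal k} with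
  | real_scalars => @idfun R
  | complex_scalars => @conjc R
  end.

Definition scal_re (k : scalars) : scal k -> R :=
  match k return scal k -> R with
  | real_scalars => id
  | complex_scalars => @complex.Re R
  end.

(* A complex integral is taken on the real and imaginary parts. *)
Definition scal_integral d (T : measurableType d) (P : probability T R)
    (k : scalars) : (T -> scal k) -> scal k :=
  match k return (T -> scal k) -> scal k with
  | real_scalars => fun f => \int[P]_x f x
  | complex_scalars => fun f =>
      Complex (\int[P]_x complex.Re (f x)) (\int[P]_x complex.Im (f x))
  end.

Definition mx_integral d (T : measurableType d) (P : probability T R)
    (k : scalars) (m n : nat) (f : T -> 'M[scal k]_(m, n)) :
    'M[scal k]_(m, n) :=
  \matrix_(i, j) scal_integral P (fun x => f x i j).

Definition adjmx (k : scalars) (m n : nat) (A : 'M[scal k]_(m, n)) :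
  'M[scal k]_(n, m) := map_mx (scal_conj k) A^T.

Definition Pos (k : scalars) (m : nat) : set 'M[scal k]_m :=
  [set S | [/\ adjmx S = S,
      forall x : 'cV_m, x != 0 -> 0 < (adjmx x *m S *m x) 0 0
    & \det S = 1]].

End Scalars.

Section Grassmannian.
Variables (F : numFieldType) (m r : nat).

Definition mxrange (X : 'M[F]_(m, r)) : {vspace 'cV[F]_m} :=
  limg (linfun (mulmx X : 'cV[F]_r -> 'cV[F]_m)).

Lemma mxrange_memP (X : 'M[F]_(m, r)) (v : 'cV[F]_m) :
  reflect (exists c : 'cV[F]_r, v = X *m c) (v \in mxrange X).
Proof.
apply: (iffP memv_imgP) => [[c _ ->]|[c ->]].
  by exists c; rewrite lfunE.
by exists c; rewrite ?memvf// lfunE.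
Qed.

(* The bound r <= m ensures that the type is inhabited, as the library
   requires of measurable spaces. *)
Record Gr (le_rm : (r <= m)%N) := MkGr {
  Gr_space :> {vspace 'cV[F]_m};
  _ : \dim Gr_space == r }.

Variable le_rm : (r <= m)%N.
Local Notation G := (Gr le_rm).

HB.instance Definition _ := [isSub for @Gr_space le_rm].
HB.instance Definition _ := [Choice of G by <:].

Lemma Gr_inhabited : exists U : {vspace 'cV[F]_m}, \dim U == r.
Proof.
pose b := vbasis {:'cV[F]_m}.
have bfree : free b by exact: basis_free (vbasisP _).
exists <<take r b>>%VS; apply/eqP.
have tfree : free (take r b).
  by move: bfree; rewrite -{1}(cat_take_drop r b); exact: catl_free.
rewrite (eqP tfree) size_takel// size_tuple dimvf.
by rewrite dim_matrix mulr1.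
Qed.

HB.instance Definition _ := isPointed.Build G
  (let: exist U dU := cid Gr_inhabited in MkGr le_rm dU).

(* The quotient topology of the map X |-> mxrange X defined on the matrices of
   rank r, which carry the subspace topology of 'M[F]_(m, r). *)
Definition Gr_open (A : set G) : Prop :=
  exists2 V : set 'M[F]_(m, r), open V &
    forall (X : 'M[F]_(m, r)) (U : G), mxrange X = val U -> (V X <-> A U).

Lemma Gr_openT : Gr_open setT.
Proof. by exists setT => //; exact: openT. Qed.

Lemma Gr_openI (A B : set G) : Gr_open A -> Gr_open B -> Gr_open (A `&` B).
Proof.
move=> [V oO OA] [Q oQ QB]; exists (V `&` Q); first exact: openI.
move=> X U XU; have [OA1 OA2] := OA X U XU; have [QB1 QB2] := QB X U XU.
by split=> [[hO hQ]|[hA hB]]; split; auto.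
Qed.

Lemma Gr_open_bigU (I : Type) (f : I -> set G) :
  (forall i, Gr_open (f i)) -> Gr_open (\bigcup_i f i).
Proof.
move=> fo; pose V i := s2val (cid2 (fo i)).
exists (\bigcup_i V i).
  by apply: bigcup_open => i _; exact: (s2valP (cid2 (fo i))).
move=> X U XU; split=> -[i _ h]; exists i => //.
  by apply/(s2valP' (cid2 (fo i)) X U XU).
by apply/(s2valP' (cid2 (fo i)) X U XU).
Qed.

HB.instance Definition _ := isOpenTopological.Build G
  Gr_openT Gr_openI Gr_open_bigU.

Definition Gr_borel := g_sigma_algebraType (@open G).

Definition Gr_frame (U : G) : 'M[F]_(m, r) :=
  \matrix_(i, j) (vbasis (val U))`_j i 0.

Lemma Gr_frame_mul (U : G) (c : 'cV[F]_r) :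
  Gr_frame U *m c = \sum_(j < r) c j 0 *: (vbasis (val U))`_j.
Proof.
apply/colP => i; rewrite mxE summxE; apply: eq_bigr => j _.
by rewrite !mxE mulrC.
Qed.

Lemma Gr_frameP (U : G) : mxrange (Gr_frame U) = U.
Proof.
have dE := eqP (valP U).
apply/vspaceP => v; apply/mxrange_memP/idP => [[c ->]|vU].
  rewrite Gr_frame_mul; apply: memv_suml => j _; apply: memvZ.
  by apply: vbasis_mem; apply: mem_nth; rewrite size_tuple dE.
exists (\col_j coord (vbasis (val U)) (cast_ord (esym dE) j) v).
rewrite Gr_frame_mul {1}(coord_vbasis vU).
rewrite (reindex (cast_ord (esym dE)))/=; last first.
  by exists (cast_ord dE) => y _; rewrite ?cast_ordK ?cast_ordKV.
by apply: eq_bigr => j _; rewrite mxE.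
Qed.

Lemma Gr_frame_inj (U : G) : injective (fun c : 'cV[F]_r => Gr_frame U *m c).
Proof.
have dE := eqP (valP U).
have bfree : free (vbasis (val U)) by exact: basis_free (vbasisP _).
move=> c e /= ce; apply/colP => j.
have h (a : 'cV[F]_r) :
    coord (vbasis (val U)) (cast_ord (esym dE) j) (Gr_frame U *m a) = a j 0.
  rewrite Gr_frame_mul (reindex (cast_ord dE))/=; last first.
    by exists (cast_ord (esym dE)) => y _; rewrite ?cast_ordK ?cast_ordKV.
  by rewrite coord_sum_free// cast_ordKV.
by rewrite -[LHS]h ce h.
Qed.

Lemma mxrange_mulP (X Y : 'M[F]_(m, r)) : mxrange X = mxrange Y ->
  exists A : 'M[F]_r, X = Y *m A.
Proof.
move=> XY.
have h j : exists c : 'cV[F]_r, col j X = Y *m c.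
  apply/mxrange_memP; rewrite -XY; apply/mxrange_memP.
  by exists (delta_mx j 0); rewrite colE.
exists (\matrix_(i, j) (sval (cid (h j))) i 0).
apply/matrixP => i j; have /colP/(_ i) := svalP (cid (h j)).
by rewrite !mxE => ->; apply: eq_bigr => l _; rewrite mxE.
Qed.

Lemma Gr_frame_unit (U : G) (X : 'M[F]_(m, r)) : mxrange X = U ->
  exists2 A : 'M[F]_r, A \in unitmx & X = Gr_frame U *m A.
Proof.
rewrite -(Gr_frameP U) => XU.
have [A XA] := mxrange_mulP XU; have [B BX] := mxrange_mulP (esym XU).
exists A => //; suff AB : A *m B = 1%:M by case: (mulmx1_unit AB).
apply/matrixP => i j.
suff /colP/(_ i) : col j (A *m B) = col j 1%:M by rewrite !mxE.
by apply: (@Gr_frame_inj U); rewrite /= !colE mul1mx !mulmxA -XA -BX.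
Qed.

End Grassmannian.

Section MaximumLikelihood.
Variables (R : realType) (k : scalars) (m r : nat) (le_rm : (r <= m)%N).
Local Notation F := (scal R k).
Local Notation G := (Gr F le_rm).
Implicit Types (S : 'M[F]_m) (U : G) (X : 'M[F]_(m, r)).

(* The density of G_S with respect to the uniform distribution G_I, where G_S
   is the law of the span of r independent centered normal vectors of
   covariance S.  The determinants are positive, so that scal_re discards
   nothing.  By frame_densityE below the value depends on the range of X
   only. *)
Definition frame_density S X : R :=
  scal_re (\det (adjmx X *m X) / \det (adjmx X *m invmx S *m X))
    `^ ((scal_dim k * m)%:R / 2).

Definition Gr_density S U : R := frame_density S (Gr_frame U).

Definition Gr_loglik (P : probability (Gr_borel F le_rm) R) S : \bar R :=
  (\int[P]_U (ln (Gr_density S U))%:E)%E.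

Definition is_GE (P : probability (Gr_borel F le_rm) R) S : Prop :=
  Pos S /\
  forall S', Pos S' -> (Gr_loglik P S' <= Gr_loglik P S)%E.

(* The projector onto U that is orthogonal for the scalar product
   (x | y)_S = x^* S^-1 y, see Gr_projP. *)
Definition Gr_proj S U : 'M[F]_m :=
  let X := Gr_frame U in
  X *m invmx (adjmx X *m invmx S *m X) *m adjmx X *m invmx S.

Lemma adjmxM p q s (A : 'M[F]_(p, q)) (B : 'M[F]_(q, s)) :
  adjmx (A *m B) = adjmx B *m adjmx A.
Proof. by rewrite /adjmx trmx_mul map_mxM. Qed.

Lemma adjmx_unit (A : 'M[F]_r) : (adjmx A \in unitmx) = (A \in unitmx).
Proof. by rewrite /adjmx map_unitmx unitmx_tr. Qed.

Lemma frame_densityE S U X : mxrange X = U ->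
  Gr_density S U = frame_density S X.
Proof.
move=> /Gr_frame_unit[A uA ->]; rewrite /Gr_density /frame_density.
set Y := Gr_frame U.
have -> : adjmx (Y *m A) *m (Y *m A) = adjmx A *m (adjmx Y *m Y) *m A.
  by rewrite adjmxM !mulmxA.
have -> : adjmx (Y *m A) *m invmx S *m (Y *m A) =
    adjmx A *m (adjmx Y *m invmx S *m Y) *m A.
  by rewrite adjmxM !mulmxA.
rewrite !det_mulmx ![_ * \det A]mulrC !mulrA -mulf_div divff ?mul1r//.
by rewrite mulf_neq0 -?unitfE -/(_ \in unitmx) -?unitmxE ?adjmx_unit.
Qed.

Lemma Pos_unitmx S : Pos S -> S \in unitmx.
Proof. by case=> _ _ dS; rewrite unitmxE dS unitr1. Qed.

Lemma Gr_gram_unit S U : Pos S ->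
  adjmx (Gr_frame U) *m invmx S *m Gr_frame U \in unitmx.
Proof.
move=> pS; have uS := Pos_unitmx pS; case: pS => aS pS dS.
set Y := Gr_frame U; set M := (X in X \in unitmx).
rewrite -unitmx_tr -row_free_unit; apply: inj_row_free => w wM.
have Mv0 : M *m w^T = 0 by rewrite -[M]trmxK -trmx_mul wM trmx0.
apply: trmx_inj; rewrite trmx0; move: w^T Mv0 => v Mv0.
apply: (@Gr_frame_inj _ _ _ _ U); rewrite mulmx0 -/Y.
apply/eqP; apply/negPn/negP => Yv0.
have z0 : invmx S *m (Y *m v) != 0.
  by apply: contra Yv0 => /eqP /(congr1 (mulmx S)); rewrite mulKVmx// mulmx0 => ->.
have := pS _ z0; rewrite -[_ *m S *m _]mulmxA mulKVmx// adjmxM adjmxM.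
have aSV : adjmx (invmx S) = invmx S.
  by rewrite /adjmx trmx_inv map_invmx -/(adjmx S) aS.
have -> : adjmx v *m adjmx Y *m adjmx (invmx S) *m (Y *m v) = adjmx v *m (M *m v).
  by rewrite aSV /M !mulmxA.
by rewrite Mv0 mulmx0 mxE ltxx.
Qed.

Lemma Gr_projP S U : Pos S ->
  (forall v : 'cV_m, Gr_proj S U *m v \in (U : {vspace 'cV_m})) /\
  (forall u v : 'cV_m, u \in (U : {vspace 'cV_m}) ->
    adjmx u *m invmx S *m (v - Gr_proj S U *m v) = 0).
Proof.
move=> pS; rewrite -(Gr_frameP U); split=> [v|u v].
  by apply/mxrange_memP; rewrite /Gr_proj -!mulmxA; eexists.
move=> /mxrange_memP[c ->]; rewrite adjmxM mulmxBr; apply/eqP; rewrite subr_eq0.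
rewrite /Gr_proj; set Y := Gr_frame U.
have /mulmxV : adjmx Y *m invmx S *m Y \in unitmx := Gr_gram_unit U pS.
set M := adjmx Y *m invmx S *m Y => MV.
have -> : adjmx c *m adjmx Y *m invmx S *m
    (Y *m invmx M *m adjmx Y *m invmx S *m v) =
    adjmx c *m (M *m invmx M) *m adjmx Y *m invmx S *m v.
  by rewrite /M !mulmxA.
by rewrite MV mulmx1.
Qed.

End MaximumLikelihood.

(* Main.v *)
(* The density of S' relative to that of S at the range U of X has logarithm
   -c log (det (X^* T X) / det (X^* H X)), where H and T are the inverses of S
   and S' and c > 0; after embedding the scalars into the complex numbers, H and
   T are simultaneously congruent to the identity and to a diagonal matrix.

   If the equation holds: with H = B^* B and T = B^* D B, an orthonormal frame
   of B U that also diagonalizes D and Jensen's inequality for the logarithm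
   give log (det (X^* T X) / det (X^* H X)) >= Re tr (pi_U K) with
   K = B^-1 (log D) B.  The mean of the right-hand side is
   (r / m) Re tr K = (r / m) log (det T / det H) = 0.

   If S is a maximizer: det (1 + t E) = 1 for all t when E = u v^T with
   v^T u = 0, so T = (1 + t E)^* H (1 + t E) is admissible.  The inequality
   log det A <= tr A - r bounds the mean log-ratio by
   2 t Re tr (Pi E) + O(t^2), Pi being the mean projector; hence v^T Pi u = 0
   whenever v^T u = 0, so Pi is scalar, and tr Pi = r. *)
Require Import Defs.
From mathcomp Require Import all_boot all_order all_algebra complex ring.
From mathcomp Require Import all_classical all_reals all_analysis.

Set Implicit Arguments.
Unset Strict Implicit.
Unset Printing Implicit Defensive.

Import Order.TTheory GRing.Theory Num.Theory.
Import numFieldNormedType.Exports.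

Local Open Scope classical_set_scope.
Local Open Scope ring_scope.
Local Open Scope sesquilinear_scope.

(** * Positive definite matrices and their simultaneous diagonalization *)

Section PositiveDefinite.
Variable C : numClosedFieldType.

Definition posdef n (H : 'M[C]_n) : Prop :=
  H^t* = H /\ forall x : 'cV_n, x != 0 -> 0 < (x^t* *m H *m x) 0 0.

Lemma trmxC_mul m n p (A : 'M[C]_(m, n)) (B : 'M[C]_(n, p)) :
  (A *m B)^t* = B^t* *m A^t*.
Proof. by rewrite trmx_mul map_mxM. Qed.

Lemma trmxC_unit n (A : 'M[C]_n) : (A^t* \in unitmx) = (A \in unitmx).
Proof. by rewrite map_unitmx unitmx_tr. Qed.

Lemma trmxC_inv n (A : 'M[C]_n) : (invmx A)^t* = invmx (A^t*).
Proof. by rewrite trmx_inv map_invmx. Qed.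

Lemma unitmx_mul0 n (A : 'M[C]_n) (x : 'cV_n) :
  A \in unitmx -> x != 0 -> A *m x != 0.
Proof.
by move=> uA; apply: contra => /eqP Ax0; rewrite -(mulKmx uA x) Ax0 mulmx0.
Qed.

Lemma inj_unitmx n (A : 'M[C]_n) :
  (forall x : 'cV_n, x != 0 -> A *m x != 0) -> A \in unitmx.
Proof.
move=> injA; rewrite -unitmx_tr -row_free_unit; apply: inj_row_free => v vA.
have Av0 : A *m v^T = 0 by rewrite -[A]trmxK -trmx_mul vA trmx0.
apply: trmx_inj; rewrite trmx0; apply/eqP; apply: contraT => /injA.
by rewrite Av0 eqxx.
Qed.

Lemma posdef_unit n (H : 'M[C]_n) : posdef H -> H \in unitmx.
Proof.
case=> _ H0; apply: inj_unitmx => x /H0; rewrite -mulmxA.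
by apply: contraTneq => ->; rewrite mulmx0 mxE ltxx.
Qed.

Lemma posdef_congr m n (H : 'M[C]_m) (X : 'M[C]_(m, n)) : posdef H ->
  (forall x : 'cV_n, x != 0 -> X *m x != 0) -> posdef (X^t* *m H *m X).
Proof.
case=> hH H0 injX; split; first by rewrite !trmxC_mul trmxCK hH mulmxA.
by move=> x /injX/H0; rewrite trmxC_mul !mulmxA.
Qed.

Lemma posdef_inv n (H : 'M[C]_n) : posdef H -> posdef (invmx H).
Proof.
move=> pH; have uH := posdef_unit pH.
have -> : invmx H = (invmx H)^t* *m H *m invmx H.
  by rewrite trmxC_inv (proj1 pH) mulVmx// mul1mx.
by apply: posdef_congr => // x; apply: unitmx_mul0; rewrite unitmx_inv.
Qed.

Lemma posdef1 n : posdef (1%:M : 'M[C]_n).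
Proof.
split=> [|x x0]; first by rewrite trmx1 map_mx1.
rewrite mulmx1 mxE lt_def sumr_ge0 ?andbT; last first.
  by move=> i _; rewrite !mxE mulrC mul_conjC_ge0.
apply: contra x0; rewrite psumr_eq0; last first.
  by move=> i _; rewrite !mxE mulrC mul_conjC_ge0.
move=> /allP xE; apply/eqP/colP => i; rewrite mxE.
have := xE i (mem_index_enum i).
by rewrite !mxE mulrC mul_conjC_eq0 => /eqP.
Qed.

Lemma hermitian_diagonalize n (H : 'M[C]_n) : H^t* = H ->
  exists2 P : 'M[C]_n, P \in unitmx /\ P^t* *m P = 1%:M &
    exists d, H = P^t* *m diag_mx d *m P.
Proof.
move=> hH; have /orthomx_spectralP : H \is normalmx.
  by apply/normalmxP; rewrite hH.
have uP := spectral_unitarymx H; set P := spectralmx H in uP *.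
rewrite invmx_unitary// => HE; exists P; last by exists (spectral_diag H).
split; first exact: unitarymx_unit.
by rewrite -invmx_unitary// mulVmx// unitarymx_unit.
Qed.

(** The form of [H] takes the value [d 0 i] at the [i]-th column of [invmx B]. *)
Lemma posdef_diag_gt0 n (H B : 'M[C]_n) d : B \in unitmx -> posdef H ->
  H = B^t* *m diag_mx d *m B -> forall i, 0 < d 0 i.
Proof.
move=> uB [_ H0] HE i; pose x := invmx B *m delta_mx i (0 : 'I_1).
have Bx : B *m x = delta_mx i 0 by rewrite /x mulKVmx.
have x0 : x != 0.
  apply: unitmx_mul0; rewrite ?unitmx_inv//; apply/eqP => /matrixP/(_ i 0).
  by rewrite !mxE !eqxx => /eqP; rewrite oner_eq0.
have := H0 _ x0; rewrite HE.
have -> : x^t* *m (B^t* *m diag_mx d *m B) *m x =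
    (B *m x)^t* *m (diag_mx d *m (B *m x)) by rewrite trmxC_mul !mulmxA.
rewrite Bx trmx_delta map_delta_mx -rowE mul_diag_mx !mxE.
by rewrite !eqxx mulr1.
Qed.

(** Scaling a spectral decomposition of [H] by the square roots of its eigenvalues gives
    [H = A^t* *m A]. A unitary [Q] then diagonalizes the Hermitian matrix
    [(invmx A)^t* *m T *m invmx A], and [B = Q *m A] serves both forms. *)
Lemma posdef_codiag n (H T : 'M[C]_n) : posdef H -> T^t* = T ->
  exists2 B : 'M[C]_n, B \in unitmx &
    H = B^t* *m B /\ exists d, T = B^t* *m diag_mx d *m B.
Proof.
move=> pH hT; have [P [uP _] [d HE]] := hermitian_diagonalize (proj1 pH).
have d0 := posdef_diag_gt0 uP pH HE.
pose s : 'rV_n := \row_i sqrtC (d 0 i).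
have s0 i : 0 < s 0 i by rewrite mxE sqrtC_gt0.
pose A := diag_mx s *m P.
have uA : A \in unitmx.
  rewrite unitmx_mul uP andbT unitmxE det_diag unitfE.
  by apply/prodf_neq0 => i _; rewrite gt_eqF.
have HA : H = A^t* *m A.
  rewrite HE /A trmxC_mul tr_diag_mx map_diag_mx !mulmxA; congr (_ *m _).
  rewrite -!mulmxA mulmx_diag; congr (_ *m diag_mx _); apply/rowP => i.
  have cs : (sqrtC (d 0 i))^* = sqrtC (d 0 i).
    by rewrite geC0_conj// sqrtC_ge0 ltW.
  by rewrite !mxE [X in _ = X * _]cs -expr2 sqrtCK.
clearbody A.
have [Q [uQ QQ] [e TE]] :
    exists2 Q : 'M[C]_n, Q \in unitmx /\ Q^t* *m Q = 1%:M &
    exists d, (invmx A)^t* *m T *m invmx A = Q^t* *m diag_mx d *m Q.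
  by apply: hermitian_diagonalize; rewrite !trmxC_mul trmxCK hT mulmxA.
exists (Q *m A); first by rewrite unitmx_mul uQ.
split.
  by rewrite trmxC_mul -[_ *m _ *m (_ *m _)]mulmxA [Q^t* *m _]mulmxA QQ mul1mx.
exists e; transitivity (A^t* *m (Q^t* *m diag_mx e *m Q) *m A); last first.
  by rewrite trmxC_mul !mulmxA.
by rewrite -TE !mulmxA trmxC_inv mulmxV ?trmxC_unit// mul1mx mulmxKV.
Qed.

Lemma posdef_det_gt0 n (H : 'M[C]_n) :
  posdef H -> 0 < \det H.
Proof.
move=> pH; have [B uB [-> _]] := posdef_codiag pH (proj1 pH).
rewrite det_mulmx det_map_mx det_tr mulrC mul_conjC_gt0.
by rewrite -unitfE -unitmxE.
Qed.

End PositiveDefinite.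

Local Open Scope complex_scope.

(** The projector onto the range of [X] that is orthogonal for the form [H]; [emb_proj] identifies
    it with [Gr_proj]. *)
Definition oproj (C : numClosedFieldType) m r (H : 'M[C]_m) (X : 'M[C]_(m, r)) :
  'M[C]_m := X *m invmx (X^t* *m H *m X) *m X^t* *m H.

Lemma invmx_mul (K : comUnitRingType) n (A B : 'M[K]_n) :
  A \in unitmx -> B \in unitmx -> invmx (A *m B) = invmx B *m invmx A.
Proof.
move=> uA uB; have uAB : A *m B \in unitmx by rewrite unitmx_mul uA.
by rewrite -[RHS](mulmxK uAB) !mulmxA mulmxKV// mulVmx// mul1mx.
Qed.

(** * Upper and lower bounds on the logarithm of a ratio of Gram determinants *)

Section LogRatio.
Variable R : realType.
Local Notation C := R[i].
Local Notation Re := (@complex.Re R).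

Definition log_ratio m r (H T : 'M[C]_m) (X : 'M[C]_(m, r)) : R :=
  ln (Re (\det (X^t* *m T *m X) / \det (X^t* *m H *m X))).

Lemma complex_ReD (x y : C) : Re (x + y) = Re x + Re y.
Proof. by case: x; case: y. Qed.

Lemma complex_Re_sum (I : Type) (s : seq I) (Q : pred I) (f : I -> C) :
  Re (\sum_(i <- s | Q i) f i) = \sum_(i <- s | Q i) Re (f i).
Proof. by elim/big_ind2 : _ => // x1 x2 y1 y2 <- <-; rewrite complex_ReD. Qed.

Lemma complex_ReMr (x : C) (y : R) : Re (x * y%:C) = Re x * y.
Proof. by case: x => a b /=; rewrite mulr0 subr0. Qed.

(** Keeping the diagonal in [R] makes the real logarithm applicable to its entries. *)
Lemma posdef_codiag_real n (H T : 'M[C]_n) : posdef H -> posdef T ->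
  exists B : 'M[C]_n, exists d : 'rV[R]_n,
  [/\ B \in unitmx, H = B^t* *m B, forall i, 0 < d 0 i &
      T = B^t* *m diag_mx (map_mx (real_complex R) d) *m B].
Proof.
move=> pH pT; have [B uB [HE [d TE]]] := posdef_codiag pH (proj1 pT).
have d0 := posdef_diag_gt0 uB pT TE.
have dE : map_mx (real_complex R) (map_mx Re d) = d.
  by apply/rowP => i; rewrite !mxE RRe_real// realE (ltW (d0 i)).
exists B, (map_mx Re d); rewrite dE; split; [exact: uB|exact: HE| |exact: TE].
by move=> i; rewrite mxE; have := d0 i; rewrite ltcE => /andP[].
Qed.

Definition sqnorm (z : C) : R := Re (z * z^*%C).

Lemma sqnormE z : (sqnorm z)%:C = z * z^*%C.
Proof. by rewrite /sqnorm RRe_real// realE mulcJ_ge0. Qed.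

Lemma sqnorm_ge0 z : 0 <= sqnorm z.
Proof. by rewrite -ler0c sqnormE mulcJ_ge0. Qed.

(* [Z] is a frame of [B *m X] that is orthonormal and in which [D] is diagonal,
   obtained by diagonalizing [X^t* *m T *m X] with respect to
   [X^t* *m H *m X]. *)
Lemma orthoframe m r (B : 'M[C]_m) (d : 'rV[R]_m) (X : 'M[C]_(m, r)) :
  let D := diag_mx (map_mx (real_complex R) d) in
  let H := B^t* *m B in let T := B^t* *m D *m B in
  B \in unitmx -> posdef H -> posdef T ->
  (forall x : 'cV_r, x != 0 -> X *m x != 0) ->
  exists Z : 'M[C]_(m, r), exists e : 'rV[R]_r,
  [/\ forall j, 0 < e 0 j,
      B *m oproj H X *m invmx B = Z *m Z^t*,
      \det (X^t* *m T *m X) / \det (X^t* *m H *m X) =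
        (\prod_j e 0 j)%:C,
      forall j, \sum_i sqnorm (Z i j) = 1 &
      Z^t* *m D *m Z = diag_mx (map_mx (real_complex R) e) /\
      forall j, e 0 j = \sum_i sqnorm (Z i j) * d 0 i].
Proof.
move=> D H T uB pH pT injX.
have [E [e [uE GE e0 FE]]] :=
  posdef_codiag_real (posdef_congr pH injX) (posdef_congr pT injX).
pose Z := B *m X *m invmx E.
have uE' : E^t* \in unitmx by rewrite trmxC_unit.
have ZZ : Z^t* *m Z = 1%:M.
  have -> : Z^t* *m Z = invmx (E^t*) *m (X^t* *m H *m X) *m invmx E.
    by rewrite /Z !trmxC_mul trmxC_inv !mulmxA.
  by rewrite GE mulmxA mulVmx// mul1mx mulmxV.
have ZDZ : Z^t* *m D *m Z = diag_mx (map_mx (real_complex R) e).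
  have -> : Z^t* *m D *m Z = invmx (E^t*) *m (X^t* *m T *m X) *m invmx E.
    by rewrite /Z !trmxC_mul trmxC_inv !mulmxA.
  by rewrite FE !mulmxA mulVmx// mul1mx mulmxK.
(* The diagonal entries of [Z^t* *m diag_mx f *m Z] are sums of the [f i] weighted by squared
   moduli: [f = 1] gives the column norms, [f = d] gives [e]. *)
have sumZ (f : 'I_m -> R) j :
    (\sum_i sqnorm (Z i j) * f i)%:C =
    (Z^t* *m diag_mx (\row_i (f i)%:C) *m Z) j j.
  rewrite -mulmxA mul_diag_mx mxE rmorph_sum; apply: eq_bigr => i _.
  rewrite rmorphM /= sqnormE !mxE.
  by rewrite mulrCA [RHS]mulrCA mulrC [_^* * _]mulrC mulrA.
exists Z, e; split=> //.
- rewrite /oproj GE invmx_mul// /Z !trmxC_mul trmxC_inv !mulmxA.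
  by rewrite mulmxK.
- rewrite GE FE !det_mulmx det_diag rmorph_prod.
  rewrite [X in X / _]mulrAC [X in X / _]mulrC mulfK.
    by apply: eq_bigr => i _; rewrite mxE.
  by rewrite mulf_neq0// -?unitfE -?unitmxE.
- move=> j; apply: (@complexI R).
  under eq_bigr do rewrite -[sqnorm _]mulr1.
  rewrite (sumZ (fun=> 1)) (_ : \row_i _ = const_mx 1).
    by rewrite diag_const_mx mulmx1 ZZ mxE eqxx.
  by apply/rowP => i; rewrite !mxE.
- split=> // j; apply: (@complexI R); rewrite (sumZ (d 0)).
  rewrite (_ : \row_i _ = map_mx (real_complex R) d).
    by rewrite ZDZ !mxE eqxx.
  by apply/rowP => i; rewrite !mxE.
Qed.

Lemma ln_le_sub1 (x : R) : 0 < x -> ln x <= x - 1.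
Proof.
by move=> x0; have := @le_ln1Dx R (x - 1); rewrite addrCA subrr addr0; apply;
  rewrite ltrBrDl subrr.
Qed.

Lemma ln_prod (I : Type) (s : seq I) (Q : pred I) (f : I -> R) :
  (forall i, 0 < f i) ->
  ln (\prod_(i <- s | Q i) f i) = \sum_(i <- s | Q i) ln (f i).
Proof.
move=> f0; suff : 0 < \prod_(i <- s | Q i) f i /\
    ln (\prod_(i <- s | Q i) f i) = \sum_(i <- s | Q i) ln (f i) by case.
elim/big_rec2 : _ => [|i y1 y2 _ [y0 yE]]; first by rewrite ltr01 ln1.
by rewrite mulr_gt0// lnM ?posrE// yE.
Qed.

(** Jensen's inequality for [ln]. With [e] the mean of [d], summing [p i * ln (d i / e) <= p i * (d
    i / e - 1)] leaves zero on the right. *)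
Lemma le_ln_mean (I : finType) (p d : I -> R) :
  (forall i, 0 <= p i) -> \sum_i p i = 1 -> (forall i, 0 < d i) ->
  \sum_i p i * ln (d i) <= ln (\sum_i p i * d i).
Proof.
move=> p0 p1 d0; set e := \sum_i p i * d i.
have e0 : 0 < e.
  rewrite lt_def sumr_ge0 ?andbT => [|i _]; last by rewrite mulr_ge0// ltW.
  apply/negP; rewrite psumr_eq0 => [/allP h|i _]; last first.
    by rewrite mulr_ge0// ltW.
  (* If the mean vanished, every weight would vanish, against their sum being 1. *)
  have : \sum_i p i = 0.
    apply: big1 => i _; have := h i (mem_index_enum i).
    by rewrite /= mulf_eq0 (gt_eqF (d0 i)) orbF => /eqP.
  by move/eqP; rewrite p1 oner_eq0.
have -> : ln e = \sum_i p i * ln e by rewrite -mulr_suml p1 mul1r.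
rewrite -subr_le0 -sumrB.
apply: (@le_trans _ _ (\sum_i (p i * d i / e - p i))).
  apply: ler_sum => i _; rewrite -mulrBr -ln_div ?posrE//.
  rewrite -mulrA -[X in _ - X]mulr1 -mulrBr ler_wpM2l//.
  by apply: ln_le_sub1; rewrite divr_gt0.
by rewrite sumrB -mulr_suml -/e p1 divff ?subrr// gt_eqF.
Qed.

(** In the frame of [orthoframe] the left-hand side is the sum of the [ln (e 0 j)], each at most
    [e 0 j - 1], and the [e 0 j] add up to the trace of [Z^t* *m D *m Z], which is the trace on the
    right by cyclicity. *)
Lemma log_ratio_le m r (H T : 'M[C]_m) (X : 'M[C]_(m, r)) :
  posdef H -> posdef T -> (forall x : 'cV_r, x != 0 -> X *m x != 0) ->
  log_ratio H T X <= Re (\tr (oproj H X *m (invmx H *m T))) - r%:R.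
Proof.
move=> pH pT injX; have [B [d [uB HE d0 TE]]] := posdef_codiag_real pH pT.
move: pH pT; rewrite /log_ratio HE TE => pH pT.
have [Z [e [e0 pE -> _ [ZDZ _]]]] := orthoframe uB pH pT injX.
move: (oproj _ X) pE => p pE.
have uB' : B^t* \in unitmx by rewrite trmxC_unit.
rewrite ln_prod// invmx_mul// !mulmxA mulmxKV// mxtrace_mulC !mulmxA pE.
rewrite -mulmxA mxtrace_mulC ZDZ mxtrace_diag complex_Re_sum.
rewrite -[r in r%:R]card_ord -sumr_const -sumrB.
by apply: ler_sum => j _; rewrite mxE; exact: ln_le_sub1.
Qed.

(* [K] is the derivative at [H] of the geodesic from [H] to [T], read in a
   basis where both matrices are diagonal; the inequality is Jensen's for [ln]
   and expresses convexity along this geodesic. *)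
Lemma log_ratio_ge m r (H T : 'M[C]_m) : posdef H -> posdef T ->
  exists2 K : 'M[C]_m, Re (\tr K) = ln (Re (\det T / \det H)) &
    forall X : 'M[C]_(m, r), (forall x : 'cV_r, x != 0 -> X *m x != 0) ->
      Re (\tr (oproj H X *m K)) <= log_ratio H T X.
Proof.
move=> pH pT; have [B [d [uB HE d0 TE]]] := posdef_codiag_real pH pT.
have uB' : B^t* \in unitmx by rewrite trmxC_unit.
pose L : 'M[C]_m := diag_mx (\row_i (ln (d 0 i))%:C).
exists (invmx B *m L *m B).
  rewrite mxtrace_mulC mulmxA mulmxV// mul1mx mxtrace_diag complex_Re_sum.
  rewrite HE TE !det_mulmx [X in X / _]mulrAC [X in X / _]mulrC.
  rewrite mulfK; last first.
    by rewrite mulf_neq0// -?unitfE -?unitmxE.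
  rewrite det_diag; under [in RHS]eq_bigr do rewrite mxE.
  by rewrite -rmorph_prod ln_prod//; apply: eq_bigr => i _; rewrite mxE.
move=> X injX; move: pH pT; rewrite /log_ratio HE TE => pH pT.
have [Z [e [e0 pE -> Z1 [_ eE]]]] := orthoframe uB pH pT injX.
move: (oproj _ X) pE => p pE.
rewrite ln_prod// !mulmxA mxtrace_mulC !mulmxA pE -mulmxA mxtrace_mulC.
rewrite /mxtrace complex_Re_sum; apply: ler_sum => j _.
rewrite eE.
have p0 i : 0 <= sqnorm (Z i j) by exact: sqnorm_ge0.
apply: le_trans (le_ln_mean p0 (Z1 j) d0).
rewrite mul_mx_diag mxE complex_Re_sum; apply: ler_sum => i _.
by rewrite !mxE mulrAC complex_ReMr [X in Re X]mulrC.
Qed.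

(** Conjugation by a fixed [B] turns every such projector into [Z *m Z^t*] with normalized columns,
    whose entries have modulus at most [r]. This uniform bound is what makes the projectors
    integrable. *)
Lemma oproj_bounded m r (H : 'M[C]_m) : posdef H ->
  exists M : C, forall (X : 'M[C]_(m, r)) i j,
    (forall x : 'cV_r, x != 0 -> X *m x != 0) -> `|oproj H X i j| <= M.
Proof.
(* Taking [T = H] suffices, since only the orthonormality of the frame matters here. *)
move=> pH; have [B [d [uB HE d0 TE]]] := posdef_codiag_real pH pH.
pose A := invmx B.
exists (\sum_i \sum_j \sum_l (\sum_k `|A i k| * r%:R) * `|B l j|) => X i j injX.
have [Z [pE Z1]] : exists Z : 'M[C]_(m, r),
    B *m oproj (B^t* *m B) X *m invmx B = Z *m Z^t* /\
    forall j, \sum_i sqnorm (Z i j) = 1.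
  have [||Z [_ [_ pE _ Z1 _]]] := orthoframe uB _ _ injX (d := d).
  - by rewrite -HE.
  - by rewrite -TE.
  - by exists Z.
have Zle k l : `|Z k l| <= 1.
  rewrite -(@expr_le1 _ 2)// sqr_normc -sqnormE -[1]/(1%:C) lecR -(Z1 l).
  by rewrite (bigD1 k)//= lerDl sumr_ge0// => *; exact: sqnorm_ge0.
rewrite HE; move: (oproj _ X) pE => p pE; have -> : p = A *m (Z *m Z^t*) *m B.
  by rewrite -pE /A !mulmxA mulVmx// mul1mx mulmxKV.
have PE k l : `|(Z *m Z^t*) k l| <= r%:R.
  rewrite mxE (le_trans (ler_norm_sum _ _ _))//.
  rewrite -[r in r%:R]card_ord -sumr_const.
  apply: ler_sum => q _; rewrite !mxE normrM mulr_ile1//.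
  by rewrite norm_conjC.
set F := fun i j : 'I_m => \sum_l (\sum_k `|A i k| * r%:R) * `|B l j|.
have F0 i' j' : 0 <= F i' j'.
  by apply: sumr_ge0 => l _; rewrite mulr_ge0// sumr_ge0.
apply: (@le_trans _ _ (F i j)); last first.
  rewrite (bigD1 i)//= (bigD1 j)//= -addrA lerDl addr_ge0//.
    by apply: sumr_ge0 => *; exact: F0.
  by apply: sumr_ge0 => i' _; apply: sumr_ge0 => *; exact: F0.
rewrite mxE (le_trans (ler_norm_sum _ _ _))//; apply: ler_sum => l _.
rewrite normrM ler_wpM2r// mxE (le_trans (ler_norm_sum _ _ _))//.
by apply: ler_sum => k _; rewrite normrM ler_wpM2l.
Qed.

End LogRatio.

(** * Embedding of both kinds of scalars into the complex numbers *)

Section Embedding.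
Variables (R : realType) (k : scalars).
Local Notation F := (scal R k).
Local Notation C := R[i].
Local Notation Re := (@complex.Re R).

(** Real matrices are also sent to [R[i]], where Hermitian matrices are diagonalized, so that one
    argument covers both kinds of scalars. *)
Definition emb : {rmorphism F -> C} :=
  match k return {rmorphism scal R k -> C} with
  | real_scalars => real_complex R
  | complex_scalars => @idfun C
  end.

Lemma embJ x : emb (scal_conj R k x) = (emb x)^*.
Proof.
by rewrite /emb; move: x; case: k => //= x; apply/esym; exact: conjc_real.
Qed.

Lemma scal_reE x : scal_re x = Re (emb x).
Proof. by rewrite /emb; move: x; case: k. Qed.

Lemma emb_adjmx m n (A : 'M[F]_(m, n)) :
  map_mx emb (adjmx A) = (map_mx emb A)^t*.
Proof. by apply/matrixP => i j; rewrite !mxE embJ. Qed.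

End Embedding.

(** For [x = a + i b] with [a] and [b] real, the cross terms cancel by symmetry of [S], and the form
    at [x] is the sum of its values at [a] and [b], which are not both zero. *)
Lemma real_posdef (R : realType) m (S : 'M[R]_m) : S^T = S ->
  (forall x : 'cV_m, x != 0 -> 0 < (x^T *m S *m x) 0 0) ->
  posdef (map_mx (real_complex R) S).
Proof.
move=> hS S0; split=> [|x x0].
  by apply/matrixP => i j; rewrite !mxE -[in RHS]hS mxE; exact: conjc_real.
pose a := map_mx (@complex.Re R) x; pose b := map_mx (@complex.Im R) x.
have S0' (c : 'cV_m) : 0 <= (c^T *m S *m c) 0 0.
  by have [->|/S0/ltW//] := eqVneq c 0; rewrite mulmx0 mxE.
pose q (u v : 'cV[R]_m) := (u^T *m S *m v) 0 0.
have qC u v : q u v = q v u.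
  by rewrite /q -[u^T *m S *m v]trmxK mxE !trmx_mul trmxK hS mulmxA.
pose toC n p (A : 'M[R]_(n, p)) := map_mx (real_complex R) A.
have xE : x = toC _ _ a + 'i%C *: toC _ _ b.
  by apply/colP => i; rewrite !mxE [LHS]complexE.
have xtE : x^t* = toC _ _ a^T - 'i%C *: toC _ _ b^T.
  apply/rowP => i; rewrite !mxE.
  change ((x i 0)^*%C =
    (complex.Re (x i 0))%:C - 'i%C * (complex.Im (x i 0))%:C).
  by case: (x i 0) => u v; rewrite /=; apply/eqP; rewrite eq_complex /=; simpc.
have -> : (x^t* *m map_mx (real_complex R) S *m x) 0 0 = (q a a + q b b)%:C.
  rewrite xtE {1}xE /toC.
  rewrite !mulmxDl !mulmxDr !mulNmx -!scalemxAl -!scalemxAr -!map_mxM.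
  have := qC b a; rewrite /q !mxE => ->; rewrite rmorphD /=.
  by ring: (sqr_i R).
rewrite ltcR.
have [a0|a0] := eqVneq a 0; last by apply: ltr_pwDl; [exact: S0|exact: S0'].
have [b0|b0] := eqVneq b 0; last by apply: ltr_wpDl; [exact: S0'|exact: S0].
by move: x0; rewrite xE a0 b0 /toC !map_mx0 scaler0 addr0 eqxx.
Qed.

(** * Densities and projectors expressed through complex frames *)

Section Frames.
Variables (R : realType) (k : scalars) (m r : nat) (le_rm : (r <= m)%N).
Local Notation F := (scal R k).
Local Notation C := R[i].
Local Notation Re := (@complex.Re R).
Local Notation emb := (@emb R k).
Local Notation G := (Gr F le_rm).
Implicit Types (S : 'M[F]_m) (U : G) (X : 'M[F]_(m, r)).

Lemma emb_posdef (S : 'M[F]_m) : Pos S -> posdef (map_mx emb S).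
Proof.
rewrite /emb /Pos /adjmx; move: S; case: k => /= S [hS S0 _].
  have idE p q (A : 'M[R]_(p, q)) : map_mx idfun A = A by apply: map_mx_id.
  apply: real_posdef => [|x /S0]; first by rewrite -[RHS]hS idE.
  by rewrite idE.
by rewrite map_mx_id//; split.
Qed.

Definition precision (S : 'M[F]_m) : 'M[C]_m := map_mx emb (invmx S).

Lemma precision_posdef S : Pos S -> posdef (precision S).
Proof.
by move=> pS; rewrite /precision map_invmx; exact/posdef_inv/emb_posdef.
Qed.

Definition cframe U : 'M[C]_(m, r) := map_mx emb (Gr_frame U).

Definition gram S X := adjmx X *m invmx S *m X.

Lemma gram_unit S U X : Pos S -> mxrange X = U -> gram S X \in unitmx.
Proof.
move=> pS /Gr_frame_unit[A uA ->]; rewrite /gram adjmxM.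
set Y := Gr_frame U.
have -> : adjmx A *m adjmx Y *m invmx S *m (Y *m A) =
   adjmx A *m (adjmx Y *m invmx S *m Y) *m A by rewrite !mulmxA.
by rewrite !unitmx_mul adjmx_unit uA Gr_gram_unit.
Qed.

(** Injectivity is needed on complex vectors even when [X] is real. It follows from invertibility of
    the Gram matrix, which the embedding preserves. *)
Lemma range_inj S U X : Pos S -> mxrange X = U ->
  forall x : 'cV_r, x != 0 -> map_mx emb X *m x != 0.
Proof.
move=> pS XU x; apply: contra => /eqP Xx.
have := gram_unit pS XU; rewrite -(map_unitmx emb) map_mxM => uG.
by rewrite -(mulKmx uG x) -mulmxA Xx !mulmx0.
Qed.

Lemma cframe_inj S U : Pos S ->
  forall x : 'cV_r, x != 0 -> cframe U *m x != 0.
Proof. by move=> pS; exact: range_inj pS (Gr_frameP U). Qed.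

Lemma emb_proj S U :
  map_mx emb (Gr_proj S U) = oproj (precision S) (cframe U).
Proof.
by rewrite /Gr_proj /oproj !map_mxM !map_invmx !map_mxM emb_adjmx -map_invmx.
Qed.

Definition density_exponent : R := (scal_dim k * m)%:R / 2.

Lemma ln_densityE S U : Pos S ->
  ln (Gr_density S U) =
  density_exponent * log_ratio (precision S) 1%:M (cframe U).
Proof.
move=> pS; rewrite /Gr_density /frame_density ln_powR; congr (_ * _).
rewrite scal_reE fmorph_div -!det_map_mx !map_mxM emb_adjmx.
by rewrite /log_ratio mulmx1.
Qed.

(** All three determinants are positive reals, so the logarithms split. With [T = 1%:M] this removes
    the uniform distribution from the comparison of two densities. *)
Lemma log_ratioB (H T T' : 'M[C]_m) (X : 'M[C]_(m, r)) :
  posdef H -> posdef T -> posdef T' ->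
  (forall x : 'cV_r, x != 0 -> X *m x != 0) ->
  log_ratio H T X - log_ratio T' T X = log_ratio H T' X.
Proof.
move=> pH pT pT' injX; rewrite /log_ratio.
have gE (A : 'M[C]_m) : posdef A ->
    exists2 a : R, 0 < a & \det (X^t* *m A *m X) = a%:C.
  move=> pA; have := posdef_det_gt0 (posdef_congr pA injX).
  case: (\det _) => a b; rewrite ltcE /= => /andP[/eqP -> a0].
  by exists a.
have [[h h0 ->] [t t0 ->] [t' t'0 ->]] := And3 (gE H pH) (gE T pT) (gE T' pT').
have rE (a b : R) : Re (a%:C / b%:C) = a / b by rewrite -fmorph_div.
rewrite !rE !ln_div ?posrE//; ring.
Qed.

End Frames.

(** * Entrywise continuity of matrix functions and of the scalar maps *)

Section MatrixContinuity.
Variables (K : numFieldType) (T : topologicalType) (x : T).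

Definition mx_continuous_at p q (A : T -> 'M[K]_(p, q)) :=
  forall i j, continuous_at x (fun t => A t i j).

Lemma continuous_atD (f g : T -> K) :
  continuous_at x f -> continuous_at x g ->
  continuous_at x (fun t => f t + g t).
Proof. exact: continuousD. Qed.

Lemma continuous_atM (f g : T -> K) :
  continuous_at x f -> continuous_at x g ->
  continuous_at x (fun t => f t * g t).
Proof. exact: continuousM. Qed.

Lemma continuous_atV (f : T -> K) : f x != 0 ->
  continuous_at x f -> continuous_at x (fun t => (f t)^-1).
Proof. exact: continuousV. Qed.

Lemma continuous_at_big (I : Type) (s : seq I) (Q : pred I) (op : K -> K -> K)
    (idx : K) (f : I -> T -> K) :
  (forall g h : T -> K, continuous_at x g -> continuous_at x h ->
    continuous_at x (fun t => op (g t) (h t))) ->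
  (forall i, Q i -> continuous_at x (f i)) ->
  continuous_at x (fun t => \big[op/idx]_(i <- s | Q i) f i t).
Proof.
move=> cop cf; elim: s => [|i s IH].
  by under eq_fun do rewrite big_nil; exact: cst_continuous.
under eq_fun do rewrite big_cons.
by case: ifPn => // Qi; apply: cop => //; exact: cf.
Qed.

Lemma mx_continuous_at_cst p q (A : 'M[K]_(p, q)) :
  mx_continuous_at (fun=> A).
Proof. by move=> i j; exact: cst_continuous. Qed.

Lemma mx_continuous_at_mul p q s (A : T -> 'M[K]_(p, q))
    (B : T -> 'M[K]_(q, s)) :
  mx_continuous_at A -> mx_continuous_at B ->
  mx_continuous_at (fun t => A t *m B t).
Proof.
move=> cA cB i j; under eq_fun do rewrite mxE.
apply: continuous_at_big => [g h cg ch|l _]; first exact: continuous_atD.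
by apply: continuous_atM; [exact: cA|exact: cB].
Qed.

Lemma continuous_at_det n (A : T -> 'M[K]_n) :
  mx_continuous_at A -> continuous_at x (fun t => \det (A t)).
Proof.
move=> cA; apply: continuous_at_big => [g h cg ch|s _].
  exact: continuous_atD.
apply: continuous_atM; first exact: cst_continuous.
apply: continuous_at_big => [g h cg ch|i _]; first exact: continuous_atM.
exact: cA.
Qed.

Lemma mx_continuous_at_adj n (A : T -> 'M[K]_n) :
  mx_continuous_at A -> mx_continuous_at (fun t => \adj (A t)).
Proof.
move=> cA i j; under eq_fun do rewrite mxE /cofactor.
apply: continuous_atM; first exact: cst_continuous.
apply: continuous_at_det => k l; under eq_fun do rewrite !mxE.
exact: cA.
Qed.

Lemma mx_continuous_at_scale p q (f : T -> K) (A : T -> 'M[K]_(p, q)) :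
  continuous_at x f -> mx_continuous_at A ->
  mx_continuous_at (fun t => f t *: A t).
Proof.
move=> cf cA i j; under eq_fun do rewrite mxE.
by apply: continuous_atM => //; exact: cA.
Qed.

End MatrixContinuity.

(** The radius is measured in [K] and the error in [L]; [w] converts the latter into the former,
    which is needed for the real part, from [R[i]] to [R]. *)
Lemma continuous_modulus (K L : numFieldType) (f : K -> L) (w : L -> K) :
  (forall e, 0 < e -> 0 < w e) ->
  (forall e x y, `|x - y| < w e -> `|f x - f y| < e) -> continuous f.
Proof.
move=> w0 fw x.
apply/(@cvgrPdist_lt _ L^o _ _ (nbhs_filter x) f (f x)) => e e0.
near=> y; apply: fw.
by near: y; apply/nbhs_ballP; exists (w e) => //=; exact: w0.
Unshelve. all: by end_near. Qed.

Lemma conjc_continuous (R : realType) :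
  continuous (@conjc R : (R[i] : numFieldType) -> (R[i] : numFieldType)).
Proof.
apply: (@continuous_modulus _ _ _ id) => // e x y.
by rewrite -rmorphB /= normcJ.
Qed.

Lemma complexRe_continuous (R : realType) :
  continuous (@complex.Re R : (R[i] : numFieldType) -> R).
Proof.
apply: (@continuous_modulus _ R _ (real_complex R)) => [e|e x y].
  by rewrite ltcR.
rewrite -ltcR; apply: le_lt_trans.
have -> : complex.Re x - complex.Re y = complex.Re (x - y).
  by case: x => a b; case: y.
exact: normc_ge_Re.
Qed.

Section ScalarContinuity.
Variables (R : realType) (k : scalars).
Local Notation F := (scal R k).

Lemma scal_conj_continuous : continuous (scal_conj R k : F -> F).
Proof. by case: k => [x|]; [exact: cvg_id|exact: conjc_continuous]. Qed.

Lemma scal_re_continuous : continuous (@scal_re R k : F -> R).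
Proof. by case: k => [x|]; [exact: cvg_id|exact: complexRe_continuous]. Qed.

Lemma mx_continuous_at_adjmx (T : topologicalType) (x : T) p q
    (A : T -> 'M[F]_(p, q)) :
  mx_continuous_at x A -> mx_continuous_at x (fun t => adjmx (A t)).
Proof.
move=> cA i j; under eq_fun do rewrite !mxE.
by apply: continuous_comp; [exact: cA|exact: scal_conj_continuous].
Qed.

End ScalarContinuity.

(** In the quotient topology, continuity in the frame makes preimages of open intervals open, and
    these intervals generate the Borel sets of [R]. *)
Lemma Gr_measurable_fun (F : numFieldType) (R : realType) (m r : nat)
    (le_rm : (r <= m)%N) (f : Gr_borel F le_rm -> R) (g : 'M[F]_(m, r) -> R) :
  (forall X (U : Gr F le_rm), mxrange X = U -> f U = g X) ->
  (forall X (U : Gr F le_rm), mxrange X = U -> {for X, continuous g}) ->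
  measurable_fun setT f.
Proof.
move=> fE cg.
apply: (measurability _ (measurable_realfun.RGenOpens.measurableE R)).
move=> _ [_ [a [b ->] <-]]; rewrite setTI; apply: sub_gen_smallest.
(* Continuity of [g] is known only at frames, so the preimage under [g] may fail to be open
   elsewhere; its interior contains the same frames. *)
exists (interior (g @^-1` `]a, b[)); first exact: open_interior.
move=> X U XU; have fU : (f @^-1` `]a, b[) U = (g @^-1` `]a, b[) X.
  by rewrite /preimage /= (fE _ _ XU).
split=> [/interior_subset|]; rewrite fU// => gab; apply: (cg _ _ XU).
by apply: open_nbhs_nbhs; split => //; exact: interval_open.
Qed.

(** * Projectors as continuous functions of the frame *)

Section FrameFunctions.
Variables (R : realType) (k : scalars) (m r : nat) (le_rm : (r <= m)%N).
Local Notation F := (scal R k).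
Local Notation G := (Gr F le_rm).
Implicit Types (S : 'M[F]_m) (U : G) (X : 'M[F]_(m, r)).

(* The projector onto the range of [X], with the inverse of the Gram matrix
   written through the adjugate so that continuity in [X] is entrywise. *)
Definition frame_proj S X : 'M[F]_m :=
  X *m ((\det (gram S X))^-1 *: \adj (gram S X)) *m adjmx X *m invmx S.

(** Two frames of [U] differ by an invertible right factor [A], which cancels against the inverse of
    the Gram matrix. *)
Lemma Gr_projE S U X : Pos S -> mxrange X = U -> Gr_proj S U = frame_proj S X.
Proof.
move=> pS XU; have uX := gram_unit pS XU; rewrite /frame_proj.
have -> : (\det (gram S X))^-1 *: \adj (gram S X) = invmx (gram S X).
  by rewrite /invmx uX.
have [A uA XE] := Gr_frame_unit XU; rewrite /Gr_proj {}XE {uX XU}.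
set Y := Gr_frame U; pose M := adjmx Y *m invmx S *m Y.
have uM : M \in unitmx by exact: Gr_gram_unit.
have uA' : adjmx A \in unitmx by rewrite adjmx_unit.
have -> : gram S (Y *m A) = adjmx A *m (M *m A).
  by rewrite /gram adjmxM !mulmxA.
rewrite -/M adjmxM invmx_mul ?unitmx_mul ?uM// invmx_mul// !mulmxA.
by rewrite mulmxK// mulmxKV.
Qed.

Lemma mx_continuous_at_gram S X : mx_continuous_at X (gram S).
Proof.
have cX : mx_continuous_at X id by move=> i j; exact: coord_continuous.
apply: mx_continuous_at_mul => //; apply: mx_continuous_at_mul.
  exact: mx_continuous_at_adjmx.
exact: mx_continuous_at_cst.
Qed.

Lemma mx_continuous_at_frame_proj S X : gram S X \in unitmx ->
  mx_continuous_at X (frame_proj S).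
Proof.
move=> uX.
have cX : mx_continuous_at X id by move=> i j; exact: coord_continuous.
have cG : mx_continuous_at X (gram S) by exact: mx_continuous_at_gram.
apply: mx_continuous_at_mul; last exact: mx_continuous_at_cst.
apply: mx_continuous_at_mul; last exact: mx_continuous_at_adjmx.
apply: mx_continuous_at_mul => //; apply: mx_continuous_at_scale.
  apply: continuous_atV; last exact: continuous_at_det.
  by rewrite -unitfE -unitmxE.
exact: mx_continuous_at_adj.
Qed.

End FrameFunctions.

Lemma mulr_continuous (K : numFieldType) (c : K) :
  continuous (fun y : K => y * c).
Proof.
by move=> y; apply: continuous_atM; [exact: cvg_id|exact: cst_continuous].
Qed.

Lemma complex_ReM (R : rcfType) (x y : R[i]) :
  complex.Re (x * y) =
  complex.Re x * complex.Re y - complex.Im x * complex.Im y.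
Proof. by case: x; case: y. Qed.

(** * Reduction of scalar integrals to real ones *)

Section Pairing.
Variables (R : realType) (k : scalars).
Local Notation F := (scal R k).
Local Notation C := R[i].
Local Notation Re := (@complex.Re R).
Local Notation emb := (@emb R k).

(** As [c] varies these real functionals separate points, so identities between scalar integrals can
    be tested on real integrals. *)
Definition re_pairing (c : C) (x : F) : R := Re (emb x * c).

Lemma re_pairing_continuous c : continuous (re_pairing c).
Proof.
rewrite /re_pairing /emb; case: k => x.
  rewrite (_ : (fun _ => _) = (fun y : R => y * Re c)); last first.
    by apply/funext => y; rewrite complex_ReM /= mul0r subr0.
  exact: mulr_continuous.
exact: continuous_comp (@mulr_continuous (C : numFieldType) c x)
  (@complexRe_continuous R _).
Qed.

Lemma re_pairing_integral d (T : measurableType d) (P : probability T R)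
    (f : T -> F) c :
  (forall a, P.-integrable setT (EFin \o (re_pairing a \o f))) ->
  \int[P]_t re_pairing c (f t) = re_pairing c (scal_integral P f).
Proof.
rewrite /re_pairing /emb; move: f; case: k => f /= fi.
  have fi1 : P.-integrable setT (EFin \o f).
    apply: eq_integrable (fi 1) => // t _.
    by rewrite /= mulr0 subr0 mulr1.
  rewrite complex_ReM /= mul0r subr0 -RintegralZr//.
  by apply: eq_Rintegral => t _; rewrite complex_ReM /= mul0r subr0.
have fre : P.-integrable setT (EFin \o (@complex.Re R \o f)).
  by apply: eq_integrable (fi 1) => // t _; rewrite /= mulr1.
(* Multiplication by [- i] moves the imaginary part to the real part. *)
have fim : P.-integrable setT (EFin \o (@complex.Im R \o f)).
  apply: eq_integrable (fi (Complex 0 (- 1))) => // t _.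
  by rewrite /= complex_ReM /= mulr0 sub0r mulrN opprK mulr1.
rewrite complex_ReM /= -!RintegralZr// -RintegralB//.
- by apply: eq_Rintegral => t _; rewrite complex_ReM.
- by apply: eq_integrable (integrableZr measurableT (Re c) fre).
- by apply: eq_integrable (integrableZr measurableT (complex.Im c) fim).
Qed.

End Pairing.

(** * Measurability of projectors and log-densities on the Grassmannian *)

Section FrameMeasurability.
Variables (R : realType) (k : scalars) (m r : nat) (le_rm : (r <= m)%N).
Local Notation F := (scal R k).
Local Notation C := R[i].
Local Notation Re := (@complex.Re R).
Local Notation emb := (@emb R k).
Local Notation G := (Gr F le_rm).
Implicit Types (S : 'M[F]_m) (U : G) (X : 'M[F]_(m, r)).

Lemma measurable_proj S i j c : Pos S ->
  measurable_fun setT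
    ((fun U => re_pairing c (Gr_proj S U i j)) : Gr_borel F le_rm -> R).
Proof.
move=> pS; apply: (@Gr_measurable_fun _ _ _ _ _ _
  (fun X => re_pairing c (frame_proj S X i j))).
  by move=> X U XU; rewrite (Gr_projE pS XU).
move=> X U XU; apply: (@continuous_comp _ _ _ (fun X => frame_proj S X i j)).
  exact: mx_continuous_at_frame_proj (gram_unit pS XU) i j.
exact: re_pairing_continuous.
Qed.

Lemma density_ratio_gt0 S U X : Pos S -> mxrange X = U ->
  0 < scal_re (\det (adjmx X *m X) / \det (adjmx X *m invmx S *m X)).
Proof.
move=> pS XU; have injX := range_inj pS XU.
rewrite scal_reE fmorph_div -!det_map_mx !map_mxM emb_adjmx.
have := posdef_det_gt0 (posdef_congr (posdef1 _ m) injX); rewrite mulmx1 => d1.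
have d2 := posdef_det_gt0 (posdef_congr (precision_posdef pS) injX).
by have := divr_gt0 d1 d2; rewrite ltcE => /andP[].
Qed.

Lemma measurable_ln_density S : Pos S ->
  measurable_fun setT ((fun U => ln (Gr_density S U)) : Gr_borel F le_rm -> R).
Proof.
move=> pS; apply: (@Gr_measurable_fun _ _ _ _ _ _
  (fun X => ln (frame_density S X))).
  by move=> X U XU; rewrite (frame_densityE _ XU).
move=> X U XU.
pose q X := \det (adjmx X *m X) / \det (adjmx X *m invmx S *m X) : F.
rewrite (_ : (fun X => _) =
  (fun X => density_exponent R k m * ln (scal_re (q X)))).
  apply: continuous_atM; first exact: cst_continuous.
  apply: (@continuous_comp _ _ _ (fun X => scal_re (q X))).
    apply: continuous_comp; last exact: scal_re_continuous.
    have cX : mx_continuous_at X id by move=> i j; exact: coord_continuous.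
    apply: continuous_atM.
      apply: continuous_at_det; apply: mx_continuous_at_mul => //.
      exact: mx_continuous_at_adjmx.
    apply: continuous_atV; last exact/continuous_at_det/mx_continuous_at_gram.
    by rewrite -unitfE -unitmxE; exact: gram_unit XU.
  by apply: continuous_ln; exact: density_ratio_gt0 XU.
by apply/funext => Y; rewrite /frame_density ln_powR.
Qed.

End FrameMeasurability.

(** * Trace identities for projectors, followed by algebraic lemmas on perturbations *)

Section Projections.
Variable R : realType.
Local Notation C := R[i].
Local Notation Re := (@complex.Re R).
Variables (m r : nat) (H : 'M[C]_m) (X : 'M[C]_(m, r)).
Hypotheses (pH : posdef H) (injX : forall x : 'cV_r, x != 0 -> X *m x != 0).

Lemma tr_oproj : \tr (oproj H X) = r%:R.
Proof.
have [G GE] : exists G, G = X^t* *m H *m X by eexists.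
have uG : G \in unitmx by rewrite GE; exact/posdef_unit/posdef_congr.
rewrite /oproj -GE -!mulmxA mxtrace_mulC -!mulmxA [X^t* *m _]mulmxA -GE.
by rewrite mulVmx// mxtrace1.
Qed.

(* [oproj H X] is self-adjoint for the scalar product defined by [H]. *)
Lemma tr_oproj_adjoint (E : 'M[C]_m) :
  Re (\tr (oproj H X *m (invmx H *m E^t* *m H))) = Re (\tr (oproj H X *m E)).
Proof.
have trJ (A : 'M[C]_m) : Re (\tr (A^t*)) = Re (\tr A).
  rewrite /mxtrace !complex_Re_sum; apply: eq_bigr => i _.
  by rewrite !mxE; case: (A i i).
have uH := posdef_unit pH; rewrite -[LHS]trJ; congr Re.
have [G GE] : exists G, G = X^t* *m H *m X by eexists.
have hG : G^t* = G by rewrite GE; exact: (posdef_congr pH injX).1.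
rewrite /oproj -GE !trmxC_mul !trmxCK !trmxC_inv hG (proj1 pH).
rewrite !mulmxA mulmxKV// -!mulmxA mxtrace_mulC !mulmxA [RHS]mxtrace_mulC.
by rewrite !mulmxA.
Qed.

End Projections.

(** The matrix determinant lemma, obtained from two block triangular factorizations of one
    matrix. *)
Lemma det1D_rank1 (K : comNzRingType) n (u v : 'cV[K]_n) :
  \det (1%:M + u *m v^T) = 1 + (v^T *m u) 0 0.
Proof.
have E1 : block_mx 1%:M u (- v^T) 1%:M =
    block_mx 1%:M 0 (- v^T) 1%:M *m block_mx 1%:M u 0 (1%:M + v^T *m u).
  rewrite mulmx_block !(mul1mx, mul0mx, mulmx0, mulmx1, addr0, mulNmx).
  by rewrite addrCA addNr addr0.
have E2 : block_mx 1%:M u (- v^T) 1%:M =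
    block_mx (1%:M + u *m v^T) u 0 1%:M *m block_mx 1%:M 0 (- v^T) 1%:M.
  rewrite mulmx_block !(mul1mx, mul0mx, mulmx0, mulmx1, addr0, add0r, mulmxN).
  by rewrite addrK.
have := congr1 determinant E1.
rewrite {1}E2 !det_mulmx !(det_ublock, det_lblock).
by rewrite !det1 !mulr1 !mul1r => ->; rewrite det_mx11 !mxE eqxx.
Qed.

Lemma linear_coef0 (R : realFieldType) (a b : R) :
  (forall t, 0 <= t * a + t ^+ 2 * b) -> a = 0.
Proof.
move=> h; apply/eqP; apply: contraT => a0.
(* Since [q > b], the value at [t = - a / q], namely [(a / q) ^+ 2 * (b - q)], is negative unless
   [a = 0]. *)
pose q := `|b| + 1; have q0 : 0 < q by rewrite ltr_wpDl.
have := h (- a / q).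
have -> : - a / q * a + (- a / q) ^+ 2 * b = (a / q) ^+ 2 * (b - q).
  by field; rewrite gt_eqF.
rewrite pmulr_rge0 ?subr_ge0.
  by rewrite leNgt (le_lt_trans (ler_norm b))// /q ltrDl.
by rewrite exprn_even_gt0//= mulf_neq0// invr_eq0 gt_eqF.
Qed.

Lemma complex_eq0_Re (R : rcfType) (z : R[i]) :
  (forall c : R[i], complex.Re (z * c) = 0) -> z = 0.
Proof.
case: z => a b h; have := h (Complex a (- b)).
rewrite /= mulrN opprK => /eqP; rewrite paddr_eq0 -?expr2 ?sqr_ge0//.
by rewrite !sqrf_eq0 => /andP[/eqP -> /eqP ->].
Qed.

(** * Integrals of bounded functions and of finite sums *)

Section Integration.
Context d (T : measurableType d) (R : realType) (P : probability T R).
Implicit Types f g : T -> R.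

Lemma bounded_integrable f (M : R) : measurable_fun setT f ->
  (forall t, `|f t| <= M) -> P.-integrable setT (EFin \o f).
Proof.
move=> mf fM; apply: measurable_bounded_integrable => //.
  exact: fin_num_fun_lty.
exists M; split; first exact: num_real.
by move=> N MN t _; exact: le_trans (fM t) (ltW MN).
Qed.

(** Both claims go through one induction, as additivity of the integral requires integrability of
    the tail. *)
Lemma Rintegral_sum (I : Type) (s : seq I) (f : I -> T -> R) :
  (forall i, P.-integrable setT (EFin \o f i)) ->
  P.-integrable setT (EFin \o (fun t => \sum_(i <- s) f i t)) /\
  \int[P]_t (\sum_(i <- s) f i t) = \sum_(i <- s) \int[P]_t f i t.
Proof.
move=> fi; elim: s => [|i s [IHi IH]].
  split; last first.
    by under eq_Rintegral do rewrite big_nil;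
      rewrite big_nil Rintegral_cst// mul0r.
  by under eq_fun do rewrite big_nil; exact: integrable0.
split.
  apply: eq_integrable (integrableD measurableT (fi i) IHi) => // t _.
  by rewrite /= big_cons.
by under eq_Rintegral do rewrite big_cons; rewrite RintegralD// IH big_cons.
Qed.

End Integration.

(** Pairs of distinct basis vectors kill the off-diagonal entries; the pair [e i + e j], [e i - e j]
    then equates the diagonal ones. *)
Lemma isotropic_scalar (K : fieldType) n (A : 'M[K]_n) :
  (forall u v : 'cV_n, (v^T *m u) 0 0 = 0 -> (v^T *m A *m u) 0 0 = 0) ->
  forall i j, A i j = A i i *+ (i == j) /\ A i i = A j j.
Proof.
move=> hA i j.
pose e a : 'cV[K]_n := delta_mx a 0.
have bE a b : ((e a)^T *m A *m e b) 0 0 = A a b.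
  by rewrite trmx_delta -rowE -colE !mxE.
have dE a b : ((e a)^T *m e b) 0 0 = (a == b)%:R.
  by rewrite trmx_delta -rowE !mxE eqxx andbT.
have offdiag a b : a != b -> A a b = 0.
  by move=> /negPf ab; rewrite -bE hA// dE ab.
have [->|ij] := eqVneq i j; first by [].
split; first by rewrite offdiag.
have := hA (e i + e j) (e i - e j).
rewrite linearB /= !mulmxBl !mulmxDr.
have sE (B1 B2 B3 B4 : 'M[K]_1) :
    (B1 + B2 - (B3 + B4)) 0 0 = B1 0 0 + B2 0 0 - (B3 0 0 + B4 0 0).
  by rewrite !mxE.
rewrite !sE !bE !dE !eqxx (negPf ij) eq_sym (negPf ij).
rewrite (offdiag i j)// (offdiag j i) 1?eq_sym//.
rewrite !addr0 !add0r subrr => /(_ erefl)/eqP.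
by rewrite subr_eq0 => /eqP.
Qed.

(** Sorts the perturbed form by powers of [t], with [E'] standing for the adjoint of [E] in the
    first variation. *)
Lemma mulmx_perturb (K : comUnitRingType) n (H E E' : 'M[K]_n) (t : K) :
  H \in unitmx ->
  invmx H *m ((1%:M + t *: E') *m H *m (1%:M + t *: E)) =
  1%:M + t *: E + t *: (invmx H *m E' *m H) +
  t ^+ 2 *: (invmx H *m E' *m H *m E).
Proof.
move=> uH; rewrite !(mulmxDl, mulmxDr, mul1mx, mulmx1) -!scalemxAl -!scalemxAr.
rewrite scalerA -expr2 !mulmxA mulVmx// mul1mx !addrA; congr (_ + _).
by rewrite addrAC.
Qed.

(** * The log-likelihood and the two implications *)

Section Likelihood.
Variables (R : realType) (k : scalars) (m r : nat) (le_rm : (r <= m)%N).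
Local Notation F := (scal R k).
Local Notation C := R[i].
Local Notation Re := (@complex.Re R).
Local Notation emb := (@emb R k).
Local Notation G := (Gr F le_rm).
Variable P : probability (Gr_borel F le_rm) R.
Implicit Types (S : 'M[F]_m) (U : G) (K : 'M[C]_m).

Definition tr_pairing K (A : 'M[F]_m) : R := Re (\tr (map_mx emb A *m K)).

Lemma tr_pairingE K A :
  tr_pairing K A = \sum_i \sum_j re_pairing (K j i) (A i j).
Proof.
rewrite /tr_pairing /mxtrace complex_Re_sum; apply: eq_bigr => i _.
by rewrite mxE complex_Re_sum; apply: eq_bigr => j _; rewrite mxE.
Qed.

Lemma re_pairing_proj_integrable S i j c : Pos S ->
  P.-integrable setT (EFin \o (fun U => re_pairing c (Gr_proj S U i j))).
Proof.
move=> pS; have [M MP] := @oproj_bounded R m r _ (precision_posdef pS).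
apply: (@bounded_integrable _ _ _ _ _ (Re (M * `|c|))).
  exact: measurable_proj.
move=> U; have : `|emb (Gr_proj S U i j) * c| <= M * `|c|.
  rewrite normrM ler_wpM2r//; have := MP _ i j (cframe_inj U pS).
  by rewrite -emb_proj mxE.
move=> /(le_trans (normc_ge_Re _)); rewrite lecE => /andP[_].
exact.
Qed.

Lemma tr_pairing_proj_integral S K : Pos S ->
  P.-integrable setT (EFin \o (fun U => tr_pairing K (Gr_proj S U))) /\
  \int[P]_U tr_pairing K (Gr_proj S U) =
  tr_pairing K (mx_integral P (Gr_proj S)).
Proof.
move=> pS.
have ijP i j := re_pairing_proj_integrable i j (K j i) pS.
have iP i := Rintegral_sum (index_enum 'I_m) (ijP i).
have [sP sE] := Rintegral_sum (index_enum 'I_m) (fun i => (iP i).1).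
split; first by apply: eq_integrable sP => // U _; rewrite /= tr_pairingE.
rewrite tr_pairingE; under eq_Rintegral do rewrite tr_pairingE.
rewrite sE; apply: eq_bigr => i _; rewrite (iP i).2; apply: eq_bigr => j _.
rewrite mxE -re_pairing_integral// => a.
exact: re_pairing_proj_integrable.
Qed.

Lemma log_ratio_upper S (T : 'M[C]_m) U : Pos S -> posdef T ->
  log_ratio (precision S) T (cframe U) <=
    tr_pairing (invmx (precision S) *m T) (Gr_proj S U) - r%:R.
Proof.
move=> pS pT; rewrite /tr_pairing emb_proj.
exact: log_ratio_le (precision_posdef pS) pT (cframe_inj U pS).
Qed.

Lemma tr_bounded (H K : 'M[C]_m) : posdef H -> exists M : R,
  forall X : 'M[C]_(m, r), (forall x : 'cV_r, x != 0 -> X *m x != 0) ->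
  Re (\tr (oproj H X *m K)) <= M.
Proof.
move=> /(@oproj_bounded R m r)[M MP].
exists (Re (\sum_i \sum_j M * `|K j i|)) => X injX.
have : `|\tr (oproj H X *m K)| <= \sum_i \sum_j M * `|K j i|.
  rewrite /mxtrace (le_trans (ler_norm_sum _ _ _))//; apply: ler_sum => i _.
  rewrite mxE (le_trans (ler_norm_sum _ _ _))//; apply: ler_sum => j _.
  by rewrite normrM ler_wpM2r// MP.
move=> /(le_trans (normc_ge_Re _)); rewrite lecE => /andP[_] /=.
by apply: le_trans; exact: ler_norm.
Qed.

(** The log-density is bounded: [log_ratio_le] bounds the log-ratio of [precision S] and [1%:M] from
    above, and the same bound with the two forms exchanged bounds it from below. *)
Lemma ln_density_integrable S : Pos S ->
  P.-integrable setT (EFin \o (fun U => ln (Gr_density S U))).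
Proof.
move=> pS; have pH := precision_posdef pS; have p1 := posdef1 C m.
have [M1 M1P] := tr_bounded (invmx (precision S) *m 1%:M) pH.
have [M2 M2P] := tr_bounded (invmx 1%:M *m precision S) p1.
apply: (@bounded_integrable _ _ _ _ _
  (density_exponent R k m * (`|M1| + `|M2|))).
  exact: measurable_ln_density.
move=> U; have injU := cframe_inj U pS.
have e0 : 0 <= density_exponent R k m by rewrite divr_ge0.
rewrite ln_densityE// normrM ger0_norm// ler_wpM2l// ler_norml.
apply/andP; split.
  have -> : log_ratio (precision S) 1%:M (cframe U) =
      - log_ratio 1%:M (precision S) (cframe U).
    move: (precision S) (cframe U) pH injU => H X pH injX.
    have L11 : log_ratio 1%:M 1%:M X = 0.
      by have := log_ratioB p1 p1 p1 injX; rewrite subrr.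
    by rewrite -(log_ratioB p1 p1 pH injX) L11 sub0r opprK.
  rewrite lerN2 (le_trans (log_ratio_le p1 pH injU))// lerBlDr.
  rewrite (le_trans (M2P _ injU))// (le_trans (ler_norm _))//.
  by rewrite -addrA addrCA lerDl addr_ge0.
rewrite (le_trans (log_ratio_le pH p1 injU))// lerBlDr.
rewrite (le_trans (M1P _ injU))// (le_trans (ler_norm _))//.
by rewrite -addrA lerDl addr_ge0.
Qed.

Lemma ln_densityB S S' U : Pos S -> Pos S' ->
  ln (Gr_density S U) - ln (Gr_density S' U) =
  density_exponent R k m * log_ratio (precision S) (precision S') (cframe U).
Proof.
move=> pS pS'.
rewrite (ln_densityE U pS) (ln_densityE U pS') -mulrBr; congr (_ * _).
by apply: log_ratioB; [exact: precision_posdef|exact: posdef1|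
  exact: precision_posdef|exact: (cframe_inj U pS)].
Qed.

(** The log-ratio is a difference of integrable log-densities divided by the exponent, which is
    nonzero because [0 < m]. *)
Lemma log_ratio_integrable S S' : (0 < m)%N -> Pos S -> Pos S' ->
  P.-integrable setT
    (EFin \o (fun U => log_ratio (precision S) (precision S') (cframe U))).
Proof.
move=> m0 pS pS'; have e0 : density_exponent R k m != 0.
  by rewrite mulf_neq0 ?invr_eq0 ?pnatr_eq0// -lt0n muln_gt0 m0 andbT; case: k.
have dB := integrableB measurableT (ln_density_integrable pS)
  (ln_density_integrable pS').
apply: eq_integrable
  (integrableZl measurableT (density_exponent R k m)^-1 dB) => //.
by move=> U _; rewrite /= -EFinB ln_densityB// -EFinM mulKf.
Qed.

Lemma le_loglik S S' : (0 < m)%N -> Pos S -> Pos S' ->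
  (Gr_loglik P S' <= Gr_loglik P S)%E =
  (0 <= \int[P]_U log_ratio (precision S) (precision S') (cframe U)).
Proof.
move=> m0 pS pS'; have e0 : 0 < density_exponent R k m.
  by rewrite divr_gt0// ltr0n muln_gt0 m0 andbT; case: k.
have llE S0 : Pos S0 -> Gr_loglik P S0 = (\int[P]_U ln (Gr_density S0 U))%:E.
  move=> pS0; rewrite /Rintegral fineK//.
  exact: (integrable_fin_num measurableT (ln_density_integrable pS0)).
rewrite !llE// lee_fin -subr_ge0 -RintegralB//;
  try exact: ln_density_integrable.
under eq_Rintegral do rewrite ln_densityB//.
by rewrite RintegralZl ?pmulr_rge0//; exact: log_ratio_integrable.
Qed.

Lemma tr_proj S U : Pos S -> \tr (map_mx emb (Gr_proj S U)) = r%:R.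
Proof.
by move=> pS; rewrite emb_proj tr_oproj//;
  [exact: precision_posdef|exact: (cframe_inj U pS)].
Qed.

(** Every projector has trace [r]; the trace passes to the mean after testing against the real
    functionals [Re (_ * c)]. *)
Lemma tr_mean_proj S : Pos S -> \tr (mx_integral P (Gr_proj S)) = r%:R.
Proof.
move=> pS; apply: (@fmorph_inj _ _ emb); apply/eqP.
rewrite rmorph_nat -subr_eq0; apply/eqP; apply: complex_eq0_Re => c.
have -> : Re ((emb (\tr (mx_integral P (Gr_proj S))) - r%:R) * c) =
    tr_pairing c%:M (mx_integral P (Gr_proj S)) - Re (r%:R * c).
  rewrite /tr_pairing scalar_mxC mul_scalar_mx mxtraceZ mulrBl -trace_map_mx.
  by rewrite [c * _]mulrC -raddfB.
rewrite -(tr_pairing_proj_integral _ pS).2.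
under eq_Rintegral.
  move=> U _; rewrite /tr_pairing scalar_mxC mul_scalar_mx mxtraceZ tr_proj//.
  over.
have PT : fine (P setT) = 1.
  by have -> : P setT = 1%E by exact: probability_setT.
by rewrite Rintegral_cst// [X in _ * X]PT mulr1 [c * _]mulrC subrr.
Qed.

Lemma tr_pairing_scalar K (a : F) : tr_pairing K a%:M = Re (emb a * \tr K).
Proof. by rewrite /tr_pairing map_scalar_mx mul_scalar_mx mxtraceZ. Qed.

Lemma likelihood_equation_GE S : (0 < m)%N -> Pos S ->
  mx_integral P (Gr_proj S) = (r%:R / m%:R)%:M -> is_GE P S.
Proof.
move=> m0 pS PE; split; first exact: pS.
move=> S' pS'; rewrite (le_loglik m0 pS pS').
have [K trK KP] :=
  @log_ratio_ge R m r _ _ (precision_posdef pS) (precision_posdef pS').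
have [iK EK] := tr_pairing_proj_integral K pS.
(* The mean of the lower bound is [r / m] times [ln] of a ratio of determinants, both equal to 1 on
   [Pos]. *)
have -> : 0 = \int[P]_U tr_pairing K (Gr_proj S U).
  rewrite EK PE tr_pairing_scalar fmorph_div !rmorph_nat mulrC.
  have -> : (r%:R / m%:R : C) = (r%:R / m%:R : R)%:C.
    by rewrite fmorph_div !rmorph_nat.
  rewrite complex_ReMr trK /precision !det_map_mx !det_inv.
  case: pS => _ _ ->; case: pS' => _ _ ->.
  by rewrite invr1 rmorph1 divr1 ln1 mul0r.
apply: le_Rintegral => //; first exact: log_ratio_integrable.
move=> U _; rewrite /tr_pairing emb_proj; apply: KP.
exact: (cframe_inj U pS).
Qed.

Lemma Pos_congr S (N : 'M[F]_m) : Pos S -> \det N = 1 ->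
  Pos (N *m S *m adjmx N).
Proof.
have adjK p q (B : 'M[F]_(p, q)) : adjmx (adjmx B) = B.
  apply/matrixP => i j; rewrite !mxE; apply: (@fmorph_inj _ _ emb).
  by rewrite !embJ conjcK.
move=> [hS S0 dS] dN; have uN : N \in unitmx by rewrite unitmxE dN unitr1.
split.
- by rewrite !adjmxM hS adjK !mulmxA.
- move=> x x0; have : adjmx N *m x != 0.
    apply: contra x0 => /eqP Nx.
    have uN' : adjmx N \in unitmx by rewrite adjmx_unit.
    by rewrite -(mulKmx uN' x) Nx mulmx0.
  by move=> /S0; rewrite adjmxM adjK !mulmxA.
- by rewrite !det_mulmx dN dS !mul1r /adjmx det_map_mx det_tr dN rmorph1.
Qed.

Lemma emb_real (t : R) : exists a : F, emb a = t%:C.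
Proof. by rewrite /emb; case: k; [exists t|exists t%:C]. Qed.

Lemma tr_pairingD K K' (A : 'M[F]_m) :
  tr_pairing (K + K') A = tr_pairing K A + tr_pairing K' A.
Proof. by rewrite /tr_pairing mulmxDr mxtraceD complex_ReD. Qed.

Lemma tr_pairingZ (t : R) K (A : 'M[F]_m) :
  tr_pairing (t%:C *: K) A = t * tr_pairing K A.
Proof. by rewrite /tr_pairing -scalemxAr mxtraceZ mulrC complex_ReMr mulrC. Qed.

(** Explains the choice of competitor in the first variation: moving the covariance by [invmx N]
    moves its inverse by congruence with [N]. *)
Lemma precision_congr S (N : 'M[F]_m) : Pos S -> N \in unitmx ->
  precision (invmx N *m S *m adjmx (invmx N)) =
  (map_mx emb N)^t* *m precision S *m map_mx emb N.
Proof.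
move=> pS uN; have uS := Pos_unitmx pS.
have uN' : adjmx (invmx N) \in unitmx.
  by rewrite /adjmx map_unitmx unitmx_tr unitmx_inv.
have aN : invmx (adjmx (invmx N)) = adjmx N.
  by rewrite /adjmx trmx_inv map_invmx invmxK.
rewrite /precision invmx_mul ?unitmx_mul ?unitmx_inv ?uN//.
by rewrite invmx_mul ?unitmx_inv// invmxK aN !map_mxM emb_adjmx mulmxA.
Qed.

(** Maximality against the perturbations [1 + t E] makes a quadratic polynomial in [t] without
    constant term nonnegative for every real [t], so its linear coefficient vanishes. *)
Lemma GE_first_variation S (E : 'M[F]_m) : (0 < m)%N -> is_GE P S ->
  (forall a : F, \det (1%:M + a *: E) = 1) ->
  tr_pairing (map_mx emb E) (mx_integral P (Gr_proj S)) = 0.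
Proof.
move=> m0 [pS maxS] detE.
pose H := precision S; have pH : posdef H := precision_posdef pS.
pose E' := map_mx emb E; pose Q := invmx H *m E'^t* *m H *m E'.
suff h t : 0 <= t * (tr_pairing E' (mx_integral P (Gr_proj S)) *+ 2) +
                t ^+ 2 * tr_pairing Q (mx_integral P (Gr_proj S)).
  by have /eqP := linear_coef0 h; rewrite mulrn_eq0 => /eqP.
have [a aE] := emb_real t; pose N := 1%:M + a *: E.
have uN : N \in unitmx by rewrite unitmxE detE unitr1.
have pS' : Pos (invmx N *m S *m adjmx (invmx N)).
  by apply: Pos_congr => //; rewrite det_inv detE invr1.
have := maxS _ pS'; rewrite (le_loglik m0 pS pS').
have [iE EE] := tr_pairing_proj_integral E' pS.
have [iQ QE] := tr_pairing_proj_integral Q pS.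
have iE2 := integrableZl measurableT (t *+ 2) iE.
have iQ2 := integrableZl measurableT (t ^+ 2) iQ.
move=> /le_trans; apply; rewrite -EE -QE mulrnAr -mulrnAl.
rewrite -!RintegralZl// -RintegralD//.
apply: le_Rintegral => //.
- exact: log_ratio_integrable.
- by apply: eq_integrable (integrableD measurableT iE2 iQ2).
move=> U _; have pT := precision_posdef pS'.
apply: le_trans (log_ratio_upper U pS pT) _.
have -> : invmx H *m precision (invmx N *m S *m adjmx (invmx N)) =
    1%:M + t%:C *: E' + t%:C *: (invmx H *m E'^t* *m H) + (t ^+ 2)%:C *: Q.
  rewrite precision_congr// -/H /N map_mxD map_mx1 map_mxZ aE -/E'.
  have -> : (1%:M + t%:C *: E')^t* = 1%:M + t%:C *: E'^t*.
    rewrite linearD linearZ /= map_mxD map_mxZ trmx1 map_mx1.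
    by congr (_ + _ *: _); exact: conjc_real.
  by rewrite mulmx_perturb ?(posdef_unit pH)// rmorphXn.
rewrite !tr_pairingD !tr_pairingZ.
(* [E'] and its [H]-adjoint contribute equally, whence the factor 2 in the linear coefficient. *)
have -> : tr_pairing (invmx H *m E'^t* *m H) (Gr_proj S U) =
    tr_pairing E' (Gr_proj S U).
  by rewrite /tr_pairing emb_proj tr_oproj_adjoint//; exact: (cframe_inj U pS).
(* This constant cancels the [- r%:R] of the upper bound. *)
have -> : tr_pairing 1%:M (Gr_proj S U) = r%:R.
  by rewrite /tr_pairing mulmx1 (tr_proj U pS) -(rmorph_nat (real_complex R)).
by rewrite le_eqVlt; apply/orP; left; apply/eqP; rewrite /=; ring.
Qed.

Lemma GE_likelihood_equation S : (0 < m)%N -> is_GE P S ->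
  mx_integral P (Gr_proj S) = (r%:R / m%:R)%:M.
Proof.
move=> m0 GES; have pS := GES.1; set A := mx_integral P _.
have /isotropic_scalar hA (u v : 'cV[F]_m) :
    (v^T *m u) 0 0 = 0 -> (v^T *m A *m u) 0 0 = 0.
  move=> uv; set z := (v^T *m A *m u) 0 0.
  (* The factor conjugate to [z] turns the real part of the trace into the squared modulus of [z],
     so its vanishing forces [z = 0] for complex scalars too. *)
  pose E := scal_conj R k z *: (u *m v^T).
  have : tr_pairing (map_mx emb E) A = 0.
    apply: GE_first_variation => // a.
    rewrite /E scalerA scalemxAl det1D_rank1 -scalemxAr mxE uv.
    by rewrite mulr0 addr0.
  rewrite /tr_pairing -map_mxM trace_map_mx /E -scalemxAr mxtraceZ.
  rewrite mulmxA mxtrace_mulC mulmxA trace_mx11 -/z rmorphM embJ => zz.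
  apply: (@fmorph_inj _ _ emb); rewrite rmorph0; move: zz.
  case: (emb z) => a b /=; rewrite mulNr opprK => /eqP.
  rewrite paddr_eq0 -?expr2 ?sqr_ge0// !sqrf_eq0.
  by move=> /andP[/eqP -> /eqP ->].
pose i0 : 'I_m := Ordinal m0.
have AE : A = (A i0 i0)%:M.
  apply/matrixP => i j; rewrite [RHS]mxE (hA i j).1; congr (_ *+ _).
  exact: (hA i i0).2.
(* [A] is now scalar, and its trace [r] determines the scalar. *)
have := tr_mean_proj pS; rewrite -/A AE mxtrace_scalar => trA.
rewrite -trA -[A i0 i0 *+ m]mulr_natr mulfK// pnatr_eq0.
by rewrite -lt0n.
Qed.

End Likelihood.

Local Close Scope complex_scope.
Local Close Scope sesquilinear_scope.

Theorem theorem2 (R : realType) (k : scalars) (m r : nat)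
    (r_gt0 : (0 < r)%N) (r_lt_m : (r < m)%N)
    (P : probability (Gr_borel (scal R k) (ltnW r_lt_m)) R)
    (S : 'M[scal R k]_m) (posS : Pos S) :
  is_GE P S <->
  mx_integral P (fun U => Gr_proj S U) = (r%:R / m%:R)%:M.
Proof.
have m_gt0 : (0 < m)%N := leq_ltn_trans (leq0n r) r_lt_m.
split; first exact: GE_likelihood_equation.
exact: likelihood_equation_GE.
Qed.
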